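(* Let the setting of the context hold, fix $x\in\mathcal{X}$, and assume $|\mathcal{L}_f(z,t)|\le M$ and $|g_t(z)|\le G$ for all $z$ and $t\in\{0,1\}$. Then $$\epsilon_f(x)\le 2\Big[G^2\big(\epsilon_{F,0}(x)+\epsilon_{F,1}(x)+M\,\mathbb{D}(x)\big)-\mathbb{V}_Y(x)\Big],$$ where $\mathbb{D}(x):=\sum_{t\in\{0,1\}}\sqrt{D_{\mathrm{KL}}(q_t(\cdot\mid x)\,\Vert\, q_{1-t}(\cdot\mid x))/2}$ and $\mathbb{V}_Y(x):=\mathbb{E}_{q(z\mid x)}\sum_{t}\mathbb{E}_{p_{Y(t)\mid\mathbb{P}_t}(y\mid z)}(y-j_t(z))^2$.
   Context: Binary treatment $T\in\{0,1\}$, covariates $X\in\mathcal{X}$, real-valued (univariate) potential outcomes $Y(t)$, observed $Y=Y(T)$, observational distribution $p(x,y,t)$, exchangeability $Y(t)\perp T\mid X$. Data generating assumption: $Y=f^*(\mathbb{M}(X),T)+e$ with $e$ zero-mean exogenous noise, and $\mu_t(X):=\mathbb{E}(Y(t)\mid X)=j_t(\mathbb{P}_t(X))$ for functions $\mathbb{P}_t$ and injective $j_t$, where $\mathbb{P}_t$ satisfies $Y(t)\perp X\mid\mathbb{P}_t(X)$; $p_{Y(t)\mid\mathbb{P}_t}(y\mid P)$ denotes the conditional density of $Y(t)$ given $\mathbb{P}_t(X)=P$. Let $f_t,g_t$ ($t=0,1$) be functions of $z$ and $q_\phi(z\mid x,y,t)$ any conditional density (encoder). Define $q_t(z\mid x):=\mathbb{E}_{p(y\mid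 x,t)}q_\phi(z\mid x,y,t)$ and $q(z\mid x):=\mathbb{E}_{p(y,t\mid x)}q_\phi(z\mid x,y,t)$. Define $\mathcal{L}_f(z,t):=g_t(z)^{-2}\int(y-f_t(z))^2p_{Y(t)\mid\mathbb{P}_t}(y\mid z)\,dy$, $\epsilon_{F,t}(x):=\mathbb{E}_{q_t(z\mid x)}\mathcal{L}_f(z,t)$, $\epsilon_{CF,t}(x):=\mathbb{E}_{q_{1-t}(z\mid x)}\mathcal{L}_f(z,t)$, $\hat\tau_f(z):=f_1(z)-f_0(z)$, $\tau_j(z):=j_1(z)-j_0(z)$, and $\epsilon_f(x):=\mathbb{E}_{q(z\mid x)}(\hat\tau_f(z)-\tau_j(z))^2$. *)

(* Defs.v *)
From HB Require Import structures.
From mathcomp Require Import all_boot all_order all_algebra.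
From mathcomp Require Import all_classical all_reals all_analysis.
Set Implicit Arguments. Unset Strict Implicit. Unset Printing Implicit Defensive.
Import Order.TTheory GRing.Theory Num.Theory.
Import numFieldNormedType.Exports.
Local Open Scope classical_set_scope.
Local Open Scope ring_scope.
Local Open Scope ereal_scope.

(* Conventions.
   - Treatments t : bool, [true] = treatment 1, [~~ t] = 1 - t.
   - Outcomes y live in R with Lebesgue measure; densities in y are w.r.t. it.
   - The latent z lives in a measurable space Z (identified, as in the paper,
     with the space of balancing-score values P_t(X)); densities in z are
     w.r.t. a sigma-finite base measure [mu] on Z.
   - [pt x t] = p(t|x), [py x t y] = p(y|x,t), [qphi x y t z] = q_phi(z|x,y,t),
     [pY t P y] = p_{Y(t)|P_t}(y|P). *)

Section Defs.
Context {R : realType} {X : Type} {d : measure_display} {Z : measurableType d}.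

Definition q_t (py : X -> bool -> R -> R) (qphi : X -> R -> bool -> Z -> R)
  (x : X) (t : bool) (z : Z) : R :=
  fine (\int[@lebesgue_measure R]_y (py x t y * qphi x y t z)%:E).

Definition q_mix (pt : X -> bool -> R) (py : X -> bool -> R -> R)
  (qphi : X -> R -> bool -> Z -> R) (x : X) (z : Z) : R :=
  (pt x false * q_t py qphi x false z + pt x true * q_t py qphi x true z)%R.

Definition L_f (f g : bool -> Z -> R) (pY : bool -> Z -> R -> R)
  (z : Z) (t : bool) : \bar R :=
  ((g t z ^+ 2)^-1)%:E *
    \int[@lebesgue_measure R]_y (((y - f t z) ^+ 2 * pY t z y)%R)%:E.

Definition eps_F (mu : {measure set Z -> \bar R}) (py : X -> bool -> R -> R)
  (qphi : X -> R -> bool -> Z -> R) (f g : bool -> Z -> R)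
  (pY : bool -> Z -> R -> R) (x : X) (t : bool) : \bar R :=
  \int[mu]_z ((q_t py qphi x t z)%:E * L_f f g pY z t).

Definition eps_f (mu : {measure set Z -> \bar R}) (pt : X -> bool -> R)
  (py : X -> bool -> R -> R) (qphi : X -> R -> bool -> Z -> R)
  (f j : bool -> Z -> R) (x : X) : \bar R :=
  \int[mu]_z ((q_mix pt py qphi x z)%:E *
     (((f true z - f false z) - (j true z - j false z)) ^+ 2)%:E).

(* pointwise integrand of KL(p || q) = \int p ln (p/q), with the usual
   conventions 0 ln(0/b) = 0 and a ln(a/0) = +oo for a > 0 *)
Definition kl_integrand (a b : R) : \bar R :=
  if a == 0%R then 0 else if b == 0%R then +oo else (a * ln (a / b))%:E.

Definition KL (mu : {measure set Z -> \bar R}) (p q : Z -> R) : \bar R :=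
  \int[mu]_z kl_integrand (p z) (q z).

Definition sqrt_half (e : \bar R) : \bar R :=
  match e with
  | r%:E => (Num.sqrt (r / 2))%:E
  | +oo => +oo
  | -oo => 0
  end.

Definition DD (mu : {measure set Z -> \bar R}) (py : X -> bool -> R -> R)
  (qphi : X -> R -> bool -> Z -> R) (x : X) : \bar R :=
  sqrt_half (KL mu (q_t py qphi x false) (q_t py qphi x true)) +
  sqrt_half (KL mu (q_t py qphi x true) (q_t py qphi x false)).

Definition VY (mu : {measure set Z -> \bar R}) (pt : X -> bool -> R)
  (py : X -> bool -> R -> R) (qphi : X -> R -> bool -> Z -> R)
  (j : bool -> Z -> R) (pY : bool -> Z -> R -> R) (x : X) : \bar R :=
  \int[mu]_z ((q_mix pt py qphi x z)%:E *
    (\int[@lebesgue_measure R]_y (((y - j false z) ^+ 2 * pY false z y)%R)%:E +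
     \int[@lebesgue_measure R]_y (((y - j true z) ^+ 2 * pY true z y)%R)%:E)).

End Defs.

(* Main.v *)
(* The bias-variance decomposition of the second moment of p_{Y(t)|P_t} about
   f_t(z) reads g_t^2 L_f(z,t) = V_t(z) + (f_t - j_t)^2, so that
   (tau_f - tau_j)^2 + 2 (V_0 + V_1) <= 2 G^2 (L_f(.,0) + L_f(.,1)).
   Averaging over the mixture q = p(0|x) q_0 + p(1|x) q_1, each loss is evaluated
   partly under the wrong encoder q_{1-t}; since 0 <= L_f <= M, replacing it by
   q_t costs at most M \int (q_{1-t} - q_t)^+, the total variation distance, which
   Pinsker's inequality bounds by sqrt (KL(q_t || q_{1-t}) / 2). *)

Require Import Defs.
From HB Require Import structures.
From mathcomp Require Import all_boot all_order all_algebra.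
From mathcomp Require Import all_classical all_reals all_analysis.
From mathcomp Require Import measurable_realfun ring lra.
Import Order.TTheory GRing.Theory Num.Theory.
Import numFieldNormedType.Exports.
Local Open Scope classical_set_scope.
Local Open Scope ring_scope.
Local Open Scope ereal_scope.

(** * Pointwise bounds on the logarithm and the KL integrand *)

(** The rational function agrees with [ln] to third order at 1. At [u = a / b] it yields [a ln (a /
    b) - a + b >= 3 (a - b)^2 / (2 (a + 2 b))], the quadratic bound behind Pinsker's inequality. *)
Lemma ln_ge_rational (R : realType) (u : R) : (0 < u)%R ->
  ((u - 1) * (5 * u + 1) / (2 * u * (u + 2)) <= ln u)%R.
Proof.
move=> u0.
(* [h - 5/2] is [ln] minus the partial fractions of the left-hand side; the
   sign of its derivative is that of [v - 1], so it is least at [1]. *)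
pose h (v : R) := (ln v + v^-1 / 4 + (v + 2)^-1 * (27 / 4))%R.
pose dh (v : R) := ((v - 1) ^+ 3 / (v ^+ 2 * (v + 2) ^+ 2))%R.
have dhE (v : R) : (0 < v)%R -> is_derive v 1%R h (dh v).
  move=> v0.
  have v_neq0 : (v != 0)%R by rewrite gt_eqF.
  have v2_neq0 : (v + 2 != 0)%R by rewrite gt_eqF // addr_gt0.
  have dln : is_derive v 1%R (@ln R) v^-1%R by exact: is_derive1_ln.
  have dinv : is_derive v 1%R (fun w : R => w^-1)%R (- v ^- 2 *: 1)%R by exact: is_deriveV.
  have dinv2 : is_derive v 1%R (fun w : R => (w + 2)^-1)%R (- (v + 2) ^- 2 *: (1 + 0))%R.
    exact: is_deriveV.
  apply: is_derive_eq.
  rewrite /dh /GRing.scale /=; field; lra.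
suff : (h 1 <= h u)%R.
  rewrite /h ln1 => hu.
  have -> : ((u - 1) * (5 * u + 1) / (2 * u * (u + 2)) =
     5 / 2 - u^-1 / 4 - (u + 2)^-1 * (27 / 4))%R by field; lra.
  have third : ((1 + 2 : R)^-1 = 1 / 3)%R by field.
  by rewrite invr1 third in hu; lra.
have cont_h (a b : R) : (0 < a)%R -> {within `[a, b]%classic, continuous h}.
  move=> a0; apply: derivable_within_continuous => v; rewrite in_itv /= => /andP[av _].
  by have [] := dhE v (lt_le_trans a0 av).
have dh_sgn (v : R) : (0 < v)%R -> exists2 w, (0 <= w)%R & dh v = (w * (v - 1))%R.
  move=> v0; exists ((v - 1) ^+ 2 / (v ^+ 2 * (v + 2) ^+ 2))%R; last by rewrite /dh exprSr mulrAC.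
  apply: divr_ge0; first exact: sqr_ge0.
  by apply: mulr_ge0; exact: sqr_ge0.
have [u1|/ltW u1] := leP u 1%R.
  have duv v : v \in `]u, 1%R[%R -> is_derive v 1%R h (dh v).
    by rewrite in_itv /= => /andP[uv _]; exact: dhE (lt_trans u0 uv).
  have [c] := MVT_segment u1 duv (cont_h u 1%R u0).
  rewrite in_itv /= => /andP[uc c1] E.
  have [w w0 Ew] := dh_sgn c (lt_le_trans u0 uc).
  by rewrite -subr_le0 E Ew -mulrA mulr_ge0_le0 // mulr_le0_ge0 // subr_cp0.
have duv v : v \in `]1%R, u[%R -> is_derive v 1%R h (dh v).
  by rewrite in_itv /= => /andP[uv _]; exact: dhE (lt_trans ltr01 uv).
have [c] := MVT_segment u1 duv (cont_h 1%R u ltr01).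
rewrite in_itv /= => /andP[c1 cu] E.
have [w w0 Ew] := dh_sgn c (lt_le_trans ltr01 c1).
by rewrite -subr_ge0 E Ew !mulr_ge0 // subr_ge0.
Qed.

(* Summing [`|e| - s / (2 c) <= c e^2 / (2 s)] with [e = a - b], [s = a + 2 b] and
   [a ln (a / b) - a + b >= 3 e^2 / (2 s)] makes Pinsker's inequality linear in
   [`|a - b|], with [c] left to be optimized after integration. *)
Lemma kl_integrand_ge (R : realType) (a b c : R) :
  (0 <= a)%R -> (0 <= b)%R -> (0 < c)%R ->
  ((3 * (`|a - b| - (a + 2 * b) / (2 * c)) / c + (a - b))%R)%:E <= kl_integrand a b.
Proof.
move=> a0 b0 c0.
have amgm (e s : R) : (0 < s)%R -> (`|e| - s / (2 * c) <= c * e ^+ 2 / (2 * s))%R.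
  move=> s0; rewrite -real_normK ?num_real //; set x := `|e|%R.
  rewrite -subr_ge0.
  have -> : (c * x ^+ 2 / (2 * s) - (x - s / (2 * c)) = (c * x - s) ^+ 2 / (2 * s * c))%R.
    by field; rewrite ?gt_eqF.
  by rewrite divr_ge0 ?sqr_ge0 // !mulr_ge0 ?ltW.
rewrite /kl_integrand; have [->|a_neq0] := eqVneq a 0%R.
  rewrite lee_fin; have [->|b_neq0] := eqVneq b 0%R.
    by rewrite !(subr0, normr0, mulr0, addr0, mul0r).
  (* At [a = 0] the integrand is 0; [amgm] with [s = 2 b] bounds the first term by [3 b / 4], which
     the summand [- b] absorbs. *)
  have bp : (0 < b)%R by rewrite lt_neqAle eq_sym b_neq0.
  have := amgm (0 - b)%R (0 + 2 * b)%R; rewrite add0r mulr_gt0 // => /(_ isT) H.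
  have H2 : (c * (0 - b) ^+ 2 / (2 * (2 * b)) = c * (b / 4))%R by field; rewrite ?gt_eqF.
  rewrite H2 in H.
  have : (3 * (`|0 - b| - 2 * b / (2 * c)) / c <= 3 * (b / 4))%R.
    by rewrite ler_pdivrMr //; lra.
  by lra.
have [->|b_neq0] := eqVneq b 0%R; first by rewrite leey.
have bp : (0 < b)%R by rewrite lt_neqAle eq_sym b_neq0.
have ap : (0 < a)%R by rewrite lt_neqAle eq_sym a_neq0.
have sp : (0 < a + 2 * b)%R by rewrite addr_gt0 // mulr_gt0.
rewrite lee_fin.
have lnab := ler_wpM2l a0 (ln_ge_rational _ _ (divr_gt0 ap bp)).
apply: le_trans lnab.
have -> : (a * ((a / b - 1) * (5 * (a / b) + 1) / (2 * (a / b) * (a / b + 2))) =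
    3 * (c * (a - b) ^+ 2 / (2 * (a + 2 * b))) / c + (a - b))%R.
  by field; rewrite !gt_eqF // divr_gt0.
by rewrite lerD2r ler_pM2r ?invr_gt0 // ler_pM2l // amgm.
Qed.

(** * Integration and Pinsker's inequality *)

Section integral_facts.
Context {d : measure_display} {T : measurableType d} {R : realType}.
Context {mu : {measure set T -> \bar R}}.
Implicit Types (f g : T -> \bar R) (p q : T -> R).

(* No integrability is needed, because [+oo - +oo = -oo] keeps the difference
   of the integrals of the positive and negative parts monotone. *)
Lemma measurable_le_integral f g :
  measurable_fun setT f -> measurable_fun setT g -> (forall x, f x <= g x) ->
  \int[mu]_x f x <= \int[mu]_x g x.
Proof.
move=> mf mg fg; rewrite integralE [leRHS]integralE leeB //.
- apply: ge0_le_integral => //; [exact: measurable_funepos..|].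
  by move=> x _; apply: (@funepos_le _ _ setT) => [y _|]; rewrite ?in_setT.
- apply: ge0_le_integral => //; [exact: measurable_funeneg..|].
  by move=> x _; apply: (@funeneg_le _ _ setT) => [y _|]; rewrite ?in_setT.
Qed.

Lemma ge0_integrable p : measurable_fun setT p -> (forall x, 0 <= p x)%R ->
  \int[mu]_x (p x)%:E < +oo -> mu.-integrable setT (EFin \o p).
Proof.
move=> mp p0 plty; apply/integrableP; split; first exact/measurable_EFinP.
by under eq_integral => x _ do rewrite /= ger0_norm //.
Qed.

Lemma ge0_integralD_EFin p q :
  measurable_fun setT p -> (forall x, 0 <= p x)%R ->
  measurable_fun setT q -> (forall x, 0 <= q x)%R ->
  \int[mu]_x (p x + q x)%:E = \int[mu]_x (p x)%:E + \int[mu]_x (q x)%:E.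
Proof.
move=> mp p0 mq q0; under eq_integral do rewrite EFinD.
by apply: ge0_integralD => // [x _||x _|]; rewrite ?lee_fin //; exact/measurable_EFinP.
Qed.

Lemma ge0_integralZl_EFinM (k : R) p :
  (0 <= k)%R -> measurable_fun setT p -> (forall x, 0 <= p x)%R ->
  \int[mu]_x (k * p x)%:E = k%:E * \int[mu]_x (p x)%:E.
Proof.
move=> k0 mp p0; under eq_integral do rewrite EFinM.
by apply: ge0_integralZl_EFin => // [x _|]; rewrite ?lee_fin //; exact/measurable_EFinP.
Qed.

Lemma integral_lincomb3 (a b c : R) (p q r : T -> R) :
  mu.-integrable setT (EFin \o p) -> mu.-integrable setT (EFin \o q) ->
  mu.-integrable setT (EFin \o r) ->
  \int[mu]_x ((a * p x + b * q x + c * r x)%R)%:E =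
  a%:E * \int[mu]_x (p x)%:E + b%:E * \int[mu]_x (q x)%:E +
  c%:E * \int[mu]_x (r x)%:E.
Proof.
move=> ip iq ir.
have iZ k (s : T -> R) : mu.-integrable setT (EFin \o s) ->
  mu.-integrable setT (fun x => k%:E * (s x)%:E) by exact: integrableZl.
under eq_integral do rewrite !EFinD !EFinM.
rewrite integralD //; [|exact/integrableD/iZ/iq/iZ/ip|exact/iZ/ir].
by rewrite integralD ?integralZl //; exact: iZ.
Qed.

Lemma measurable_kl_integrand p q :
  measurable_fun setT p -> measurable_fun setT q ->
  (forall x, 0 <= p x)%R -> (forall x, 0 <= q x)%R ->
  measurable_fun setT (fun x => kl_integrand (p x) (q x)).
Proof.
move=> mp mq p0 q0.
(* In the last branch both densities are positive, so the logarithm of the quotient splits into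
   measurable pieces. *)
rewrite (_ : (fun x => _) = (fun x => if p x == 0%R then 0 else
   if q x == 0%R then +oo else (p x * (ln (p x) - ln (q x)))%:E)); last first.
  apply/funext => x; rewrite /kl_integrand.
  case: eqVneq => // p_neq0; case: eqVneq => // q_neq0.
  by rewrite ln_div // posrE lt_neqAle eq_sym ?p_neq0 ?q_neq0 /=.
apply: measurable_fun_ifT; [exact: measurable_fun_eqr|exact: measurable_cst|].
apply: measurable_fun_ifT; [exact: measurable_fun_eqr|exact: measurable_cst|].
apply/measurable_EFinP/measurable_funM => //.
by apply: measurable_funB; exact: measurableT_comp.
Qed.

Lemma sqrt_half_ge0 (e : \bar R) : 0 <= sqrt_half e.
Proof. by case: e => [r||] //=; rewrite lee_fin sqrtr_ge0. Qed.

(** As [p] and [q] have equal mass, the integral of [(q - p)^+] is half their L1 distance, that is,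
    the total variation. The one-sided form is the excess that arises when one encoder replaces the
    other. *)
Lemma pinsker p q :
  measurable_fun setT p -> measurable_fun setT q ->
  (forall x, 0 <= p x)%R -> (forall x, 0 <= q x)%R ->
  \int[mu]_x (p x)%:E = 1 -> \int[mu]_x (q x)%:E = 1 ->
  \int[mu]_x (Num.max (q x - p x) 0)%:E <= sqrt_half (KL mu p q).
Proof.
move=> mp mq p0 q0 p1 q1.
pose m x := Num.max (q x - p x)%R 0%R.
have m0 x : (0 <= m x)%R by rewrite /m le_max lexx orbT.
have mm : measurable_fun setT m by apply: measurable_maxr => //; exact: measurable_funB.
have ip : mu.-integrable setT (EFin \o p) by apply: ge0_integrable; rewrite ?p1 ?ltry.
have iq : mu.-integrable setT (EFin \o q) by apply: ge0_integrable; rewrite ?q1 ?ltry.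
have im : mu.-integrable setT (EFin \o m).
  apply: (le_integrable _ _ _ iq) => //; first exact/measurable_EFinP.
  move=> x _ /=; rewrite lee_fin !ger0_norm //.
  by rewrite /m ge_max q0 andbT gerBl.
change (\int[mu]_x (m x)%:E <= sqrt_half (KL mu p q)).
have := integrable_fin_num measurableT im.
have : 0 <= \int[mu]_x (m x)%:E by apply: integral_ge0 => x _; rewrite lee_fin.
case Ev : (\int[mu]_x (m x)%:E) => [v| |] // + _; rewrite lee_fin le_eqVlt.
case/orP => [/eqP <-|v0]; first exact: sqrt_half_ge0.
(* This choice of [c] minimizes [c K / 3 + 3 / (2 c)] at [K = 2 v^2], the
   equality case. *)
pose c := (3 / (2 * v))%R.
have c0 : (0 < c)%R by rewrite /c divr_gt0 // mulr_gt0.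
(* [l] is the bound of [kl_integrand_ge] after substituting [|p - q| = 2 m - (q - p)]; being linear
   in [m], [p], [q], it integrates from the values [v], 1, 1. *)
pose l x := ((6 / c) * m x + (3 / c - 3 / (2 * c ^+ 2) + 1) * p x +
             (- (3 / c) - 3 / c ^+ 2 - 1) * q x)%R.
have ml : measurable_fun setT l.
  by apply: measurable_funD; [apply: measurable_funD|]; exact: measurable_funM.
have le_l x : (l x)%:E <= kl_integrand (p x) (q x).
  apply: le_trans (kl_integrand_ge _ _ _ _ (p0 x) (q0 x) c0); rewrite lee_fin.
  have -> : (`|p x - q x| = 2 * m x - (q x - p x))%R.
    rewrite /m distrC; case: leP => h; first by rewrite ler0_norm //; lra.
    by rewrite gtr0_norm //; lra.
  rewrite le_eqVlt; apply/orP; left; apply/eqP; rewrite /l; field.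
  by rewrite gt_eqF.
have : (2 * v ^+ 2)%:E <= KL mu p q.
  have <- : \int[mu]_x (l x)%:E = (2 * v ^+ 2)%:E.
    rewrite integral_lincomb3 // Ev p1 q1 !mule1 -!EFinM -!EFinD; congr EFin.
    by rewrite /c; field; rewrite gt_eqF.
  apply: measurable_le_integral => //; first exact/measurable_EFinP.
  exact: measurable_kl_integrand.
case: (KL mu p q) => [r|_|//] /=; last exact: leey.
rewrite !lee_fin => vr; rewrite -(ger0_norm (ltW v0)) -sqrtr_sqr.
by apply: ler_wsqrtr; lra.
Qed.

End integral_facts.

(** * Second moments of the outcome density *)

(** The square about the mean [m] is expanded about [a], because finiteness is assumed for the
    second moment about [a]; the bound on [L_f] will supply it. *)
Lemma integral_sqr_shift (R : realType) (k : R -> R) (a m : R) :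
  measurable_fun setT k -> (forall y, 0 <= k y)%R ->
  \int[@lebesgue_measure R]_y (k y)%:E = 1 ->
  (@lebesgue_measure R).-integrable setT (fun y => (y * k y)%:E) ->
  \int[@lebesgue_measure R]_y (y * k y)%:E = m%:E ->
  \int[@lebesgue_measure R]_y ((y - a) ^+ 2 * k y)%:E < +oo ->
  \int[@lebesgue_measure R]_y ((y - a) ^+ 2 * k y)%:E =
  \int[@lebesgue_measure R]_y ((y - m) ^+ 2 * k y)%:E + ((a - m) ^+ 2)%:E.
Proof.
move=> mk k0 k1 iyk ykm Alty.
have Age0 : 0 <= \int[@lebesgue_measure R]_y ((y - a) ^+ 2 * k y)%:E.
  by apply: integral_ge0 => y _; rewrite lee_fin mulr_ge0 ?sqr_ge0.
have iA : (@lebesgue_measure R).-integrable setT (EFin \o (fun y => (y - a) ^+ 2 * k y)%R).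
  apply: ge0_integrable => // [|y]; last by rewrite mulr_ge0 ?sqr_ge0.
  by apply: measurable_funM => //; apply: measurable_funX; exact: measurable_funB.
have ik : (@lebesgue_measure R).-integrable setT (EFin \o k).
  by apply: ge0_integrable; rewrite ?k1 ?ltry.
have -> : \int[@lebesgue_measure R]_y ((y - m) ^+ 2 * k y)%:E =
    \int[@lebesgue_measure R]_y (1 * ((y - a) ^+ 2 * k y) +
      (2 * (a - m)) * (y * k y) + (m ^+ 2 - a ^+ 2) * k y)%:E.
  by apply: eq_integral => y _; congr EFin; ring.
rewrite integral_lincomb3 // ykm k1 mule1 mul1e.
move: Age0 Alty; case: (\int[_]_y _) => [A| |] // _ _.
by rewrite -EFinM -!EFinD; congr EFin; ring.
Qed.

Lemma measurable_integral_sqr (R : realType) (d : measure_display) (Z : measurableType d)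
  (a : Z -> R) (k : Z -> R -> R) :
  measurable_fun setT a ->
  measurable_fun setT (fun zy : Z * R => k zy.1 zy.2) ->
  (forall z y, 0 <= k z y)%R ->
  measurable_fun setT (fun z => \int[@lebesgue_measure R]_y ((y - a z) ^+ 2 * k z y)%:E).
Proof.
move=> ma mk k0.
pose h (zy : Z * R) := ((zy.2 - a zy.1) ^+ 2 * k zy.1 zy.2)%:E.
apply: (measurable_fun_fubini_tonelli_F (m2 := @lebesgue_measure R) h).
  apply/measurable_EFinP/measurable_funM => //; apply: measurable_funX.
  by apply: measurable_funB => //; exact: measurableT_comp.
by move=> zy; rewrite lee_fin mulr_ge0 ?sqr_ge0.
Qed.

(** * The averaged encoder as a probability density *)

Section encoder_density.
Context {R : realType} {X : Type} {d : measure_display} {Z : measurableType d}.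
Variables (mu : {sigma_finite_measure set Z -> \bar R}).
Variables (py : X -> bool -> R -> R) (qphi : X -> R -> bool -> Z -> R).
Variables (x : X) (t : bool).
Hypotheses (py_ge0 : forall y, (0 <= py x t y)%R)
  (py_meas : measurable_fun setT (py x t))
  (py_int : \int[@lebesgue_measure R]_y (py x t y)%:E = 1)
  (qphi_ge0 : forall y z, (0 <= qphi x y t z)%R)
  (qphi_meas : measurable_fun setT (fun yz : R * Z => qphi x yz.1 t yz.2))
  (qphi_int : forall y, \int[mu]_z (qphi x y t z)%:E = 1).

Let h (yz : R * Z) := (py x t yz.1 * qphi x yz.1 t yz.2)%:E.

Let h_ge0 yz : 0 <= h yz.
Proof. by rewrite lee_fin mulr_ge0. Qed.

Let h_meas : measurable_fun setT h.
Proof. by apply/measurable_EFinP/measurable_funM => //; exact: measurableT_comp. Qed.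

Let marginal z := \int[@lebesgue_measure R]_y h (y, z).

Let marginal_ge0 z : 0 <= marginal z.
Proof. exact: integral_ge0. Qed.

Let marginal_meas : measurable_fun setT marginal.
Proof. exact: (measurable_fun_fubini_tonelli_G (m1 := @lebesgue_measure R) h). Qed.

Let marginal_int : \int[mu]_z marginal z = 1.
Proof.
rewrite /marginal -(fubini_tonelli (m1 := @lebesgue_measure R) (m2 := mu) h) // -py_int.
apply: eq_integral => y _; rewrite /h /=.
under eq_integral do rewrite EFinM.
rewrite ge0_integralZl_EFin // ?qphi_int ?mule1 //; last first.
  apply/measurable_EFinP.
  exact: (measurableT_comp qphi_meas (measurable_pair1 y)).
by move=> z _; rewrite lee_fin.
Qed.

Lemma q_t_ge0 z : (0 <= q_t py qphi x t z)%R.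
Proof. exact: fine_ge0 (marginal_ge0 z). Qed.

Lemma q_t_measurable : measurable_fun setT (q_t py qphi x t).
Proof. exact: measurableT_comp marginal_meas. Qed.

(** By Tonelli the extended-real marginal has mass 1, hence is finite almost everywhere, so [fine]
    alters it only on a null set. *)
Lemma q_t_integral : \int[mu]_z (q_t py qphi x t z)%:E = 1.
Proof.
rewrite -marginal_int; apply: ge0_ae_eq_integral => //.
- exact/measurable_EFinP/q_t_measurable.
- by move=> z _; rewrite lee_fin q_t_ge0.
have /(integrable_ae measurableT) : mu.-integrable setT marginal.
  apply/integrableP; split => //.
  by under eq_integral do rewrite gee0_abs //; rewrite marginal_int ltry.
by apply: filterS => z + _ => /(_ I) /fineK.
Qed.

End encoder_density.

(** * Inequalities between the integrands *)

(** The mixture exceeds [q] by [p' (q' - q)]: this is dropped where negative, and elsewhere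
    [p' <= 1] and [l <= M] apply. *)
Lemma encoder_loss_swap_le (R : realType) (p p' q q' l M : R) :
  (0 <= p')%R -> (p + p' = 1)%R -> (p' <= 1)%R -> (0 <= l <= M)%R ->
  ((p * q + p' * q') * l <= q * l + M * Num.max (q' - q) 0)%R.
Proof.
move=> p'0 pp' p'1 /andP[l0 lM].
have -> : ((p * q + p' * q') * l = q * l + p' * (l * (q' - q)))%R.
  by rewrite (_ : p = 1 - p')%R; [ring|lra].
rewrite lerD2l; have [h|/ltW h] := leP (q' - q)%R 0%R.
  by rewrite mulr0 mulr_ge0_le0 // mulr_ge0_le0.
apply: (@le_trans _ _ (l * (q' - q))%R); last exact: ler_wpM2r.
by rewrite ler_piMl // mulr_ge0.
Qed.

(** Keeping the variances on the left makes both sides nonnegative in the application, so they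
    integrate without subtraction. *)
Lemma pehe_pointwise_le (R : realType)
  (p0 p1 q0 q1 v0 v1 l0 l1 f0 f1 j0 j1 g0 g1 G M : R) :
  (0 <= p0)%R -> (0 <= p1)%R -> (p0 + p1 = 1)%R -> (0 <= q0)%R -> (0 <= q1)%R ->
  (0 <= l0 <= M)%R -> (0 <= l1 <= M)%R -> (`|g0| <= G)%R -> (`|g1| <= G)%R ->
  (g0 ^+ 2 * l0 = v0 + (f0 - j0) ^+ 2)%R -> (g1 ^+ 2 * l1 = v1 + (f1 - j1) ^+ 2)%R ->
  ((p0 * q0 + p1 * q1) * ((f1 - f0) - (j1 - j0)) ^+ 2 +
     2 * ((p0 * q0 + p1 * q1) * (v0 + v1)) <=
   2 * G ^+ 2 * (q0 * l0 + q1 * l1 + M * Num.max (q1 - q0) 0 + M * Num.max (q0 - q1) 0))%R.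
Proof.
move=> p00 p10 p01 q00 q10 hl0 hl1 g0G g1G e0 e1.
have le_sqr g : (`|g| <= G)%R -> (g ^+ 2 <= G ^+ 2)%R.
  by move=> gG; rewrite -real_normK ?num_real // lerXn2r ?nnegrE // (le_trans _ gG).
have le_gl (g l : R) : (`|g| <= G)%R -> (0 <= l <= M)%R -> (g ^+ 2 * l <= G ^+ 2 * l)%R.
  by move=> gG /andP[l_ge0 _]; apply: ler_wpM2r => //; exact: le_sqr.
have gl0 := le_gl _ _ g0G hl0; have gl1 := le_gl _ _ g1G hl1.
set q := (p0 * q0 + p1 * q1)%R.
have q_ge0 : (0 <= q)%R by rewrite addr_ge0 // mulr_ge0.
apply: (@le_trans _ _ (2 * G ^+ 2 * (q * l0 + q * l1))%R).
  rewrite [leLHS](_ : _ = q * (((f1 - f0) - (j1 - j0)) ^+ 2 + 2 * (v0 + v1)))%R; last by ring.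
  rewrite [leRHS](_ : _ = q * (2 * (G ^+ 2 * l0 + G ^+ 2 * l1)))%R; last by ring.
  apply: ler_wpM2l => //.
  apply: (@le_trans _ _ (2 * (g0 ^+ 2 * l0 + g1 ^+ 2 * l1))%R); last by lra.
  (* With [a = f1 - j1] and [b = f0 - j0], the gap is [2 (a^2 + b^2) - (a - b)^2 = (a + b)^2]. *)
  rewrite e0 e1 -subr_ge0.
  rewrite (_ : (_ - _)%R = (((f1 - j1) + (f0 - j0)) ^+ 2)%R); last by ring.
  exact: sqr_ge0.
apply: ler_wpM2l; first by rewrite mulr_ge0 ?sqr_ge0.
have H0 := encoder_loss_swap_le _ p0 p1 q0 q1 l0 M p10 p01 _ hl0.
have H1 := encoder_loss_swap_le _ p1 p0 q1 q0 l1 M p00 _ _ hl1.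
rewrite (addrC (p1 * q1)%R) in H1.
by rewrite /q; have := H0 ltac:(lra); have := H1 ltac:(lra) ltac:(lra); lra.
Qed.

(** * Integration of the pointwise bound *)

Theorem theorem2 (R : realType) (X : Type) (d : measure_display)
  (Z : measurableType d) (mu : {sigma_finite_measure set Z -> \bar R})
  (pt : X -> bool -> R) (py : X -> bool -> R -> R)
  (qphi : X -> R -> bool -> Z -> R) (pY : bool -> Z -> R -> R)
  (f g j : bool -> Z -> R) (x : X) (M G : R)
  (* p(t|x) is a probability on {0,1} *)
  (pt_ge0 : forall t, (0 <= pt x t)%R)
  (pt_sum : (pt x false + pt x true)%R = 1%R)
  (* p(y|x,t) is a probability density on R *)
  (py_ge0 : forall t y, (0 <= py x t y)%R)
  (py_meas : forall t, measurable_fun setT (py x t))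
  (py_int : forall t, \int[@lebesgue_measure R]_y (py x t y)%:E = 1)
  (* q_phi(.|x,y,t) is a probability density on Z w.r.t. mu, jointly
     measurable in (y, z) *)
  (qphi_ge0 : forall y t z, (0 <= qphi x y t z)%R)
  (qphi_meas : forall t, measurable_fun setT (fun yz : R * Z => qphi x yz.1 t yz.2))
  (qphi_int : forall y t, \int[mu]_z (qphi x y t z)%:E = 1)
  (* p_{Y(t)|P_t}(.|P) is a probability density on R, jointly measurable *)
  (pY_ge0 : forall t P y, (0 <= pY t P y)%R)
  (pY_meas : forall t, measurable_fun setT (fun zy : Z * R => pY t zy.1 zy.2))
  (pY_int : forall t P, \int[@lebesgue_measure R]_y (pY t P y)%:E = 1)
  (* setting: mu_t = j_t o P_t with j_t injective and Y(t) _||_ X | P_t(X),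
     hence E[Y(t) | P_t(X) = P] = j_t(P) *)
  (j_inj : forall t, injective (j t))
  (pY_mean_int : forall t P,
     (@lebesgue_measure R).-integrable setT (fun y => (y * pY t P y)%:E))
  (pY_mean : forall t P,
     \int[@lebesgue_measure R]_y (y * pY t P y)%:E = (j t P)%:E)
  (* regularity of f_t, g_t, j_t; g_t nonvanishing so that L_f is defined *)
  (f_meas : forall t, measurable_fun setT (f t))
  (g_meas : forall t, measurable_fun setT (g t))
  (j_meas : forall t, measurable_fun setT (j t))
  (g_neq0 : forall t z, g t z != 0%R)
  (* the bounds of the theorem *)
  (HM : forall z t, `| L_f f g pY z t | <= M%:E)
  (HG : forall z t, (`| g t z | <= G)%R) :
  eps_f mu pt py qphi f j x <=
    2%:E * ((G ^+ 2)%:E *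
              (eps_F mu py qphi f g pY x false + eps_F mu py qphi f g pY x true
               + M%:E * DD mu py qphi x)
            - VY mu pt py qphi j pY x).
Proof.
pose q := q_t py qphi x; pose l t z := fine (L_f f g pY z t).
pose A t z := \int[@lebesgue_measure R]_y ((y - f t z) ^+ 2 * pY t z y)%:E.
pose V t z := \int[@lebesgue_measure R]_y ((y - j t z) ^+ 2 * pY t z y)%:E.
have q0 t z : (0 <= q t z)%R by exact: q_t_ge0.
have qm t : measurable_fun setT (q t) by exact: q_t_measurable.
have q1 t : \int[mu]_z (q t z)%:E = 1 by exact: q_t_integral.
have A0 t z : 0 <= A t z by apply: integral_ge0 => y _; rewrite lee_fin mulr_ge0 ?sqr_ge0.
have V0 t z : 0 <= V t z by apply: integral_ge0 => y _; rewrite lee_fin mulr_ge0 ?sqr_ge0.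
have Am t : measurable_fun setT (A t) by exact: measurable_integral_sqr.
have Vm t : measurable_fun setT (V t) by exact: measurable_integral_sqr.
have g2gt0 t z : (0 < g t z ^+ 2)%R by rewrite exprn_even_gt0 //= g_neq0.
(* The bound [M] makes the loss finite, and with it the moments [A] and [V], so the integrands
   become real-valued. *)
have LE t z : L_f f g pY z t = (l t z)%:E.
  rewrite fineK // fin_num_abs; exact: le_lt_trans (HM z t) (ltry _).
have AE t z : A t z = (g t z ^+ 2 * l t z)%:E.
  rewrite EFinM -LE /L_f muleA -EFinM mulfV ?mul1e //; exact: lt0r_neq0.
have l0M t z : (0 <= l t z <= M)%R.
  have l0 : (0 <= l t z)%R by rewrite -lee_fin -LE; apply: mule_ge0 (A0 t z); rewrite lee_fin invr_ge0 ltW.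
  by rewrite l0 /= -lee_fin -LE -(gee0_abs (x := L_f f g pY z t)) // LE lee_fin.
have lm t : measurable_fun setT (l t).
  apply: measurableT_comp => //; apply: emeasurable_funM; last exact: Am.
  apply/measurable_EFinP.
  (* On positive reals the reciprocal is [expR (- ln _)], a composition of measurable functions. *)
  rewrite (_ : (fun z => _) = (fun z => expR (- ln (g t z ^+ 2)))%R); last first.
    by apply/funext => z; rewrite expRN lnK // posrE.
  apply: measurableT_comp => //; apply: measurable_funN.
  by apply: measurableT_comp => //; exact: measurable_funX.
have AVE t z : A t z = V t z + ((f t z - j t z) ^+ 2)%:E.
  apply: integral_sqr_shift => //.
    exact: (measurableT_comp (pY_meas t) (measurable_pair1 z)).
  by change (A t z < +oo); rewrite AE ltry.
pose v t z := fine (V t z).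
have VE t z : V t z = (v t z)%:E.
  by rewrite fineK //; move: (V0 t z) (AVE t z); rewrite AE; case: (V t z).
have vE t z : (g t z ^+ 2 * l t z = v t z + (f t z - j t z) ^+ 2)%R.
  by apply: EFin_inj; rewrite -AE AVE VE.
have v0 t z : (0 <= v t z)%R by rewrite fine_ge0.
have vm t : measurable_fun setT (v t) by exact: measurableT_comp.
(* A negative [M] is contradicted at any point of [Z], and [Z] has a point since [q true] integrates
   to 1. *)
have M0 : (0 <= M)%R.
  have [//|M_lt0] := leP 0%R M; have := q1 true; rewrite integral0_eq => [[/eqP]|z _].
    by rewrite eq_sym oner_eq0.
  by have /andP[l0 lM] := l0M true z; have := le_lt_trans (le_trans l0 lM) M_lt0; rewrite ltxx.
pose m s t z := Num.max (q s z - q t z)%R 0%R.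
have m0 s t z : (0 <= m s t z)%R by rewrite /m le_max lexx orbT.
have mm s t : measurable_fun setT (m s t).
  by apply: measurable_maxr => //; exact: measurable_funB.
pose eF t := \int[mu]_z (q t z * l t z)%:E.
have eFE t : eps_F mu py qphi f g pY x t = eF t.
  by apply: eq_integral => z _; rewrite LE.
pose qq z := q_mix pt py qphi x z.
have qq0 z : (0 <= qq z)%R by rewrite addr_ge0 // mulr_ge0.
have qqm : measurable_fun setT qq by apply: measurable_funD; exact: measurable_funM.
have VYE : VY mu pt py qphi j pY x = \int[mu]_z (qq z * (v false z + v true z))%:E.
  by apply: eq_integral => z _; rewrite [RHS]EFinM (EFinD (v false z)) -!VE.
pose D z := ((f true z - f false z) - (j true z - j false z))%R.
have Dm : measurable_fun setT D by do 2 apply: measurable_funB.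
have epsE : eps_f mu pt py qphi f j x = \int[mu]_z (qq z * D z ^+ 2)%:E by [].
pose tv s t := \int[mu]_z (m s t z)%:E.
(* [B] is the bracket of the bound with total variations in place of [DD]; unlike [DD], it is always
   finite. *)
pose B := eF false + eF true + M%:E * tv true false + M%:E * tv false true.
have ql0 t z : (0 <= q t z * l t z)%R by rewrite mulr_ge0 //; case/andP: (l0M t z).
have qlm t : measurable_fun setT (fun z => (q t z * l t z)%R) by exact: measurable_funM.
have Mm0 s t z : (0 <= M * m s t z)%R by rewrite mulr_ge0.
have Mmm s t : measurable_fun setT (fun z => (M * m s t z)%R) by exact: measurable_funM.
pose b z := (q false z * l false z + q true z * l true z +
             M * m true false z + M * m false true z)%R.
have bm : measurable_fun setT b by do 3 (apply: measurable_funD => //).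
have b0 z : (0 <= b z)%R by rewrite /b !addr_ge0.
have BE : B = \int[mu]_z (b z)%:E.
  rewrite !ge0_integralD_EFin ?ge0_integralZl_EFinM //.
  - exact: measurable_funD.
  - by move=> z; rewrite addr_ge0.
  - by do 2 (apply: measurable_funD => //).
  - by move=> z; rewrite !addr_ge0.
have key : eps_f mu pt py qphi f j x + 2%:E * VY mu pt py qphi j pY x <= (2 * G ^+ 2)%:E * B.
  have qD0 z : (0 <= qq z * D z ^+ 2)%R by rewrite mulr_ge0 // sqr_ge0.
  have qDm : measurable_fun setT (fun z => (qq z * D z ^+ 2)%R).
    by apply: measurable_funM => //; exact: measurable_funX.
  have qv0 z : (0 <= qq z * (v false z + v true z))%R by rewrite mulr_ge0 // addr_ge0.
  have qvm : measurable_fun setT (fun z => (qq z * (v false z + v true z))%R).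
    by apply: measurable_funM => //; exact: measurable_funD.
  have G2 : (0 <= 2 * G ^+ 2)%R by rewrite mulr_ge0 // sqr_ge0.
  rewrite epsE VYE BE -!ge0_integralZl_EFinM // -ge0_integralD_EFin //.
  - apply: measurable_le_integral => [||z].
    + by apply/measurable_EFinP/measurable_funD => //; exact: measurable_funM.
    + by apply/measurable_EFinP; exact: measurable_funM.
    + by rewrite lee_fin; exact: pehe_pointwise_le.
  - exact: measurable_funM.
  - by move=> z; rewrite mulr_ge0.
(* [B <= 4 M]. Through [key] this makes [eps_f] and [VY] finite, so that [VY] can be moved to the
   right-hand side. *)
have Bfin : B \is a fin_num.
  have qq2m : measurable_fun setT (fun z => (q false z + q true z)%R) by exact: measurable_funD.
  have : B <= \int[mu]_z (2 * M * (q false z + q true z))%:E.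
    rewrite BE; apply: measurable_le_integral => [||z].
    - exact/measurable_EFinP.
    - by apply/measurable_EFinP; exact: measurable_funM.
    rewrite lee_fin.
    have ql t : (q t z * l t z <= q t z * M)%R.
      by apply: ler_wpM2l => //; case/andP: (l0M t z).
    have Mm s t : (M * m s t z <= M * q s z)%R.
      by apply: ler_wpM2l => //; rewrite /m ge_max q0 andbT gerBl.
    have := ql true; have := ql false; have := Mm true false; have := Mm false true.
    by rewrite /b; lra.
  rewrite ge0_integralZl_EFinM ?ge0_integralD_EFin ?q1 ?mulr_ge0 // => [Ble|z]; last first.
    by rewrite addr_ge0.
  rewrite ge0_fin_numE ?(le_lt_trans Ble) ?ltry //.
  by rewrite BE; apply: integral_ge0 => z _; rewrite lee_fin.
have BD : B <= eF false + eF true + M%:E * DD mu py qphi x.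
  have -> : M%:E * DD mu py qphi x =
      M%:E * sqrt_half (KL mu (q false) (q true)) + M%:E * sqrt_half (KL mu (q true) (q false)).
    by apply: ge0_muleDr; exact: sqrt_half_ge0.
  (* The excess of [q s] over [q t] is paid for by the divergence of [q t] from [q s], in this
     order. *)
  have M_tv s t : M%:E * tv s t <= M%:E * sqrt_half (KL mu (q t) (q s)).
    by apply: lee_wpmul2l; [rewrite lee_fin|exact: pinsker].
  by rewrite addeA; apply: leeD; [apply: leeD|].
have G2 : 0 <= (G ^+ 2)%:E by rewrite lee_fin sqr_ge0.
have eps0 : 0 <= eps_f mu pt py qphi f j x.
  by apply: integral_ge0 => z _; rewrite lee_fin mulr_ge0 // sqr_ge0.
have VY0 : 0 <= VY mu pt py qphi j pY x.
  by rewrite VYE; apply: integral_ge0 => z _; rewrite lee_fin mulr_ge0 // addr_ge0.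
apply: (@le_trans _ _ (2%:E * ((G ^+ 2)%:E * B - VY mu pt py qphi j pY x))); last first.
  by rewrite !eFE; apply: lee_wpmul2l => //; apply: leeB => //; exact: lee_wpmul2l.
rewrite -(fineK Bfin) in key *.
have fin_summands : eps_f mu pt py qphi f j x + 2%:E * VY mu pt py qphi j pY x \is a fin_num.
  rewrite ge0_fin_numE; first by rewrite (le_lt_trans key) // -EFinM ltry.
  by apply: adde_ge0 => //; exact: mule_ge0.
move: fin_summands eps0 VY0 key.
case: (eps_f _ _ _ _ _ _ _) => [e| |] //; case: (VY _ _ _ _ _ _ _) => [w| |];
  rewrite ?gt0_muley ?gt0_muleNy //.
by rewrite !lee_fin; lra.
Qed.
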